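(* Let $\mathcal G_{s^*}$ be a $C^{1+Lip}$ extension of $g_{s^*}$ (obtained by the self-similar construction described in the context). Then $\mathcal G_{s^*}$ is a period quintupling infinitely renormalizable $C^{1+Lip}$ unimodal map with a quadratic tip such that $R\mathcal G_{s^*}=\mathcal G_{s^*}$.
   Context: A unimodal map is a $C^1$ map $f:[0,1]\to[0,1]$ with a unique critical point $c$, normalized here by $f(c)=1$, $f(1)=0$. It is $C^{1+Lip}$ if its derivative is Lipschitz. It has a quadratic tip if there are a sequence $y_n\to c$ ($y_n\ne c$) and $l>0$ with $\lim_{n\to\infty}\frac{f(y_n)-f(c)}{(y_n-c)^2}=-l$. Period quintupling renormalization: $f$ is period quintupling renormalizable if $f^3(0)<c<f^8(0)$ and, with $J=[f^3(0),f^8(0)]$ a proper subinterval, the intervals $f^2(J),J,f^3(J),f^4(J),f(J)$ have pairwise disjoint interiors, lie in this order from left to right, and $f^5(J)\subset J$. Then $Rf=h^{-1}\circ f^5\circ h$ with $h:[0,1]\to J$ the orientation reversing affine homeomorphism. $f$ is period quintupling infinitely renormalizable if $R^nf$ is period quintupling renormalizable for every $n\ge0$ and the lengths of the corresponding nested intervals $J_n\ni c$ (on which $f^{5^n}$ is affinely conjugate to $R^nf$) tend to $0$. The map $g_{s^*}$: for $c\in[0,\tfrac12]$ let $u_c(x)=1-\left(\frac{x-c}{1-c}\right)^2$ on $[0,1]$, with iterates $u_c^k$. Let $f_d$ be the set of $c\in(0,\tfrac12)$ for which all of the following are positive: $u_c^5(0)$, $u_c^8(0)-u_c^3(0)$,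 $u_c^6(0)-u_c(0)$, $u_c^2(0)-u_c^7(0)$, $1-u_c^4(0)$, $u_c^3(0)-u_c^5(0)$, $u_c(0)-u_c^8(0)$, $u_c^7(0)-u_c^6(0)$, $u_c^4(0)-u_c^2(0)$. Let $c^*=0.387226\ldots$ be the unique $c\in f_d$ with $\frac{u_c^8(0)-c}{u_c^8(0)-u_c^3(0)}=c$, and $(s_1^*,\ldots,s_5^* )=\big(u_{c^*}^5(0),u_{c^*}^8(0)-u_{c^*}^3(0),u_{c^*}^6(0)-u_{c^*}(0),u_{c^*}^2(0)-u_{c^*}^7(0),1-u_{c^*}^4(0)\big)$. With $\tilde s_1(t)=s_1^*(1-t)$, $\tilde s_2(t)=u_{c^*}^3(0)+s_2^*(1-t)$, $\tilde s_3(t)=u_{c^*}(0)+s_3^*(1-t)$, $\tilde s_4(t)=u_{c^*}^2(0)-s_4^*(1-t)$, $\tilde s_5(t)=1-s_5^*(1-t)$ and $I_i^n=\tilde s_2^{\,n-1}\circ\tilde s_i([0,1])$, let $D_{s^*}=\bigcup_{n\ge1}(I_1^n\cup I_3^n\cup I_4^n\cup I_5^n)$; $g_{s^*}:D_{s^*}\to[0,1]$ is affine on each of these intervals and agrees with $u_{c^*}$ at their endpoints. Write $I_2^1=[y_1,z_1]$ ($y_1$ is an endpoint of $I_5^2$, $z_1$ an endpoint of $I_1^2$). The extension: let $F(x,y)=\big(u_{c^*}^3(0)+s_2^*(1-x),\ 1-s_5^*(1-y)\big)$ on $[0,1]^2$. Let $\psi:[0,y_1]\cup[z_1,1]\to[0,1]$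 be a $C^{1+Lip}$ map extending $g_{s^*}$ restricted to $D_{s^*}\cap([0,y_1]\cup[z_1,1])$, with positive derivative on $[0,y_1]$, negative derivative on $[z_1,1]$, and one-sided derivatives at $y_1$ and $z_1$ equal to the slopes of $g_{s^*}|_{I_5^2}$ and $g_{s^*}|_{I_1^2}$. Then $\mathcal G_{s^*}$ is the function with graph $\{(c^*,1)\}\cup\bigcup_{m\ge0}F^m(\mathrm{graph}\,\psi)$. *)

(* Defs.v *)
From mathcomp Require Import all_boot all_order all_algebra.
From mathcomp Require Import all_classical all_reals all_analysis.

Set Implicit Arguments.
Unset Strict Implicit.
Unset Printing Implicit Defensive.

Import Order.TTheory GRing.Theory Num.Theory.
Import numFieldNormedType.Exports.
Local Open Scope ring_scope.
Local Open Scope classical_set_scope.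

(** A map on [A `<=` R] is represented by a total function [R -> R] of which
    only the values on [A] matter; at an end of [A] the derivative relative to
    [A] is the one-sided derivative. *)

Definition has_deriv_within (R : realType) (A : set R) (f : R -> R) (x d : R) :=
  (f y - f x) / (y - x) @[y --> within A x^'] --> d.

Definition C1_on (R : realType) (A : set R) (f df : R -> R) :=
  (forall x, A x -> has_deriv_within A f x (df x)) /\ {within A, continuous df}.

Definition C1Lip_on (R : realType) (A : set R) (f df : R -> R) :=
  C1_on A f df /\ [lipschitz df x | x in A].

Definition C1Lip (R : realType) (A : set R) (f : R -> R) :=
  exists df : R -> R, C1Lip_on A f df.

(** [c] is the critical point. *)
Definition unimodal (R : realType) (f : R -> R) (c : R) :=
  [/\ `[0, 1] c,
      f @` `[0, 1] `<=` `[0, 1],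
      exists2 df : R -> R, C1_on `[0, 1] f df
        & forall x : R, `[0, 1] x -> (df x = 0 <-> x = c),
      f c = 1
    & f 1 = 0].

Definition quadratic_tip (R : realType) (f : R -> R) (c : R) :=
  exists (y : nat -> R) (l : R),
    [/\ forall n, `[0, 1] (y n) /\ y n != c,
        y @ \oo --> c,
        0 < l
      & (f (y n) - f c) / (y n - c) ^+ 2 @[n --> \oo] --> - l].

Definition renJ (R : realType) (f : R -> R) : set R :=
  `[iter 3 f 0, iter 8 f 0].

Definition renh (R : realType) (f : R -> R) (x : R) : R :=
  iter 8 f 0 - (iter 8 f 0 - iter 3 f 0) * x.

Definition renh_inv (R : realType) (f : R -> R) (y : R) : R :=
  (iter 8 f 0 - y) / (iter 8 f 0 - iter 3 f 0).

Definition renorm (R : realType) (f : R -> R) : R -> R :=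
  fun x => renh_inv f (iter 5 f (renh f x)).

Definition left_of (R : realType) (A B : set R) :=
  forall x y, A x -> B y -> x <= y.

Definition quint_renormalizable (R : realType) (f : R -> R) :=
  exists c : R,
    [/\ unimodal f c, iter 3 f 0 < c < iter 8 f 0, renJ f `<` `[0, 1]
      & [/\ trivIset `I_5 (fun i => (iter i f @` renJ f)°),
            left_of (iter 2 f @` renJ f) (renJ f),
            left_of (renJ f) (iter 3 f @` renJ f),
            left_of (iter 3 f @` renJ f) (iter 4 f @` renJ f)
          & left_of (iter 4 f @` renJ f) (f @` renJ f)]
        /\ iter 5 f @` renJ f `<=` renJ f].

(** The affine map from [0,1] onto the nested interval [J_n], which conjugates
    [R^n f] with the restriction of [f^(5^n)] to [J_n]. *)
Fixpoint nest (R : realType) (f : R -> R) (n : nat) (x : R) : R :=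
  if n is m.+1 then nest f m (renh (iter m (@renorm R) f) x) else x.

Definition quint_inf_renormalizable (R : realType) (f : R -> R) :=
  (forall n, quint_renormalizable (iter n (@renorm R) f)) /\
  `|nest f n 1 - nest f n 0| @[n --> \oo] --> (0 : R).

Definition u (R : realType) (c x : R) : R := 1 - ((x - c) / (1 - c)) ^+ 2.

Definition ui (R : realType) (c : R) (k : nat) : R := iter k (u c) 0.

Definition fd (R : realType) : set R :=
  [set c | [/\ 0 < c < 2^-1,
     [/\ 0 < ui c 5, 0 < ui c 8 - ui c 3, 0 < ui c 6 - ui c 1,
         0 < ui c 2 - ui c 7 & 0 < 1 - ui c 4]
   & [/\ 0 < ui c 3 - ui c 5, 0 < ui c 1 - ui c 8, 0 < ui c 7 - ui c 6
       & 0 < ui c 4 - ui c 2]]].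

Definition is_cstar (R : realType) (c : R) :=
  fd c /\ (ui c 8 - c) / (ui c 8 - ui c 3) = c.

Definition stil (R : realType) (c : R) (i : nat) (t : R) : R :=
  match i with
  | 1 => ui c 5 * (1 - t)
  | 2 => ui c 3 + (ui c 8 - ui c 3) * (1 - t)
  | 3 => ui c 1 + (ui c 6 - ui c 1) * (1 - t)
  | 4 => ui c 2 - (ui c 2 - ui c 7) * (1 - t)
  | 5 => 1 - (1 - ui c 4) * (1 - t)
  | _ => 0
  end.

Definition Ipar (R : realType) (c : R) (i n : nat) (t : R) : R :=
  iter n.-1 (stil c 2) (stil c i t).

Definition Iset (R : realType) (c : R) (i n : nat) : set R :=
  Ipar c i n @` `[0, 1].

Definition Dset (R : realType) (c : R) : set R :=
  \bigcup_(n in [set n | (1 <= n)%N])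
    (Iset c 1 n `|` Iset c 3 n `|` Iset c 4 n `|` Iset c 5 n).

Definition is_g (R : realType) (c : R) (g : R -> R) :=
  forall i n : nat, i \in [:: 1; 3; 4; 5]%N -> (1 <= n)%N ->
    [/\ exists a b : R, forall x, Iset c i n x -> g x = a * x + b,
        g (Ipar c i n 0) = u c (Ipar c i n 0)
      & g (Ipar c i n 1) = u c (Ipar c i n 1)].

Definition slope_on (R : realType) (c : R) (g : R -> R) (i n : nat) : R :=
  (g (Ipar c i n 1) - g (Ipar c i n 0)) / (Ipar c i n 1 - Ipar c i n 0).

(** [stil c 2] reverses orientation: [I_2^1 = [y1 c, z1 c]]. *)
Definition y1 (R : realType) (c : R) : R := stil c 2 1.
Definition z1 (R : realType) (c : R) : R := stil c 2 0.

Definition Adom (R : realType) (c : R) : set R := `[0, y1 c] `|` `[z1 c, 1].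

Definition is_psi (R : realType) (c : R) (g psi : R -> R) :=
  psi @` Adom c `<=` `[0, 1] /\
  (forall x, Dset c x -> Adom c x -> psi x = g x) /\
  exists2 dpsi : R -> R, C1Lip_on (Adom c) psi dpsi
    & [/\ forall x : R, `[0, y1 c] x -> 0 < dpsi x,
          forall x : R, `[z1 c, 1] x -> dpsi x < 0,
          dpsi (y1 c) = slope_on c g 5 2
        & dpsi (z1 c) = slope_on c g 1 2].

Definition graph_on (R : realType) (A : set R) (f : R -> R) : set (R * R) :=
  [set p | A p.1 /\ p.2 = f p.1].

Definition Fmap (R : realType) (c : R) (p : R * R) : R * R :=
  (stil c 2 p.1, stil c 5 p.2).

Definition calG_graph (R : realType) (c : R) (psi : R -> R) : set (R * R) :=
  (c, 1) |` \bigcup_m (iter m (Fmap c) @` graph_on (Adom c) psi).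

(** Meaningful on [0,1] once [calG_graph c psi] is known to be the graph of a
    function on [0,1]. *)
Definition calG (R : realType) (c : R) (psi : R -> R) (x : R) : R :=
  xget 0 [set y | calG_graph c psi (x, y)].

(* Main.v *)
Require Import Defs.
From mathcomp Require Import all_boot all_order all_algebra.
From mathcomp Require Import all_classical all_reals all_analysis.
From mathcomp Require Import ring lra.

Import Order.TTheory GRing.Theory Num.Theory.
Import numFieldNormedType.Exports.
Local Open Scope ring_scope.
Local Open Scope classical_set_scope.

(** The affine contraction [shrink s c], that is [x |-> c - s (x - c)], maps
    [[0,1]] onto [I_2], and [[0,1]] is the union of the point [c] and the images
    of the closed gap set [fundom = [0,1] \ int I_2] under its iterates.  So a
    map on [fundom] whose values at the four ends are compatible has exactly one
    extension [f] with [f (shrink x) = T (f x)].  The defining equation of [c]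
    says that [c] is the fixed point of the affine parametrization of [I_2];
    hence the parabola [u c] itself satisfies [u (shrink x) = tau (u x)] with
    [tau y = 1 + s^2 (y - 1)], and [tau] parametrizes [I_5].  This makes [psi],
    which agrees with [u c] at the ends of the gap, compatible with [tau], and
    the extension is [calG].

    Smoothness comes from the same mechanism one order lower.  Differentiating
    the functional equation gives [f' (shrink x) = - s f' x]; the slopes imposed
    at [y_1] and [z_1] are exactly what makes [dpsi] compatible with
    [y |-> - s y], so the derivative is itself a self-similar extension [df] of
    [dpsi].  The factor [- s] of the values equals the factor of the distances,
    so a Lipschitz constant of [dpsi] is preserved by every iterate, and [df]
    vanishes linearly at [c] ([selfsim_C1Lip]).  Likewise [1 - f] scales by
    [s^2], the square of the factor of the distances, which gives the
    differentiability at [c] and, along the orbit of the point 1, the quadratic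
    tip.

    Dynamically, [f] maps [I_2] into [I_5] by the functional equation, and then
    affinely [I_5 -> I_1 -> I_3 -> I_4 -> I_2], because on these intervals it
    interpolates [u c], which carries ends to ends.  Following the affine
    parametrizations through the cycle gives [f^5 (shrink x) = shrink (f x)]
    ([selfsim_cycle]), that is, the renormalization of [f] is [f].  Only the
    values on [[0,1]] are under control, so the arguments apply to an arbitrary
    map obeying the functional equation on [[0,1]]; this class is closed under
    renormalization, and its nested intervals have length [s^n]. *)

(** * The contraction and its fundamental domain *)

Section ScaledSelfSimilarity.
Context {R : realType}.
Implicit Types (s c x y t : R) (A B : set R).

Lemma itvccE (a b x : R) : `[a, b] x <-> a <= x <= b.
Proof. by rewrite /= in_itv /=. Qed.

Definition shrink (s c x : R) : R := c - s * (x - c).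

(** As [shrink] reverses orientation, this says that the image of [[0,1]] lies in
    its interior; [0 < c < 1] and [s < 1] follow. *)
Definition shrinks_inside (s c : R) := [/\ 0 < s, 0 < shrink s c 1 & shrink s c 0 < 1].

Definition fundom (s c : R) : set R := `[0, shrink s c 1] `|` `[shrink s c 0, 1].

Lemma iter_shrinkB s c n x : iter n (shrink s c) x - c = (- s) ^+ n * (x - c).
Proof.
elim: n => [|n IH]; first by rewrite /= expr0 mul1r.
by rewrite iterS {1}/shrink IH exprS; ring.
Qed.

Lemma exists_expr_lt s (e : R) : 0 <= s < 1 -> 0 < e -> exists n, s ^+ n < e.
Proof.
move=> /andP[s0 s1] e0.
have := @cvg_expr R s; rewrite ger0_norm// => /(_ s1) /cvgrPdist_lt /(_ e e0) [n _ Hn].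
exists n; have := Hn n (leqnn n).
by rewrite /= sub0r normrN normrX ger0_norm.
Qed.

Section Domain.
Variables (s c : R).
Hypothesis inside : shrinks_inside s c.

Lemma scale_bounds : [/\ 0 < c, c < 1 & s < 1].
Proof.
have [s0] := inside; rewrite /shrink => lt1 lt0; split.
- rewrite ltNge; apply/negP => c0.
  have : 0 <= s * (1 - c) by apply: mulr_ge0; lra.
  by lra.
- rewrite ltNge; apply/negP => c0.
  have : 0 <= s * c by apply: mulr_ge0; lra.
  by lra.
- lra.
Qed.

Lemma shrink_itv x : `[0, 1] x -> shrink s c 1 <= shrink s c x <= shrink s c 0.
Proof.
have [s0 lt1 lt0] := inside.
move/itvccE => /andP[x0 x1].
have := mulr_ge0 (ltW s0) x0; have : 0 <= s * (1 - x) by apply: mulr_ge0; lra.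
by rewrite /shrink; lra.
Qed.

Lemma shrink_itv_inv x : shrink s c 1 <= shrink s c x <= shrink s c 0 -> `[0, 1] x.
Proof.
have [s0 lt1 lt0] := inside.
rewrite /shrink => hx; apply/itvccE.
by rewrite -(ler_pM2l s0) -[x <= 1](ler_pM2l s0); lra.
Qed.

Lemma shrink_unit x : `[0, 1] x -> `[0, 1] (shrink s c x).
Proof.
have [s0 lt1 lt0] := inside.
by move=> /shrink_itv h; apply/itvccE; lra. Qed.

Lemma shrink_inj x y : shrink s c x = shrink s c y -> x = y.
Proof.
have [s0 lt1 lt0] := inside.
by rewrite /shrink => h; apply: (mulfI (lt0r_neq0 s0)); lra. Qed.

Lemma shrink_surj x : shrink s c 1 <= x <= shrink s c 0 ->
  exists2 x', `[0, 1] x' & x = shrink s c x'.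
Proof.
have [s0 lt1 lt0] := inside.
move=> hx; have e : x = shrink s c (c - (x - c) / s).
  by rewrite /shrink; field; rewrite lt0r_neq0.
by exists (c - (x - c) / s) => //; apply: shrink_itv_inv; rewrite -e.
Qed.

Lemma shrink_c : shrink s c c = c.
Proof. by rewrite /shrink; ring. Qed.

Lemma fundom_unit x : fundom s c x -> `[0, 1] x.
Proof.
have [s0 lt1 lt0] := inside.
have [c0 c1 s1] := scale_bounds; rewrite /shrink in lt1 lt0 *.
by case=> /itvccE hx; apply/itvccE; move: hx; rewrite /shrink; lra.
Qed.

Lemma fundom_or_shrink x : `[0, 1] x ->
  fundom s c x \/ shrink s c 1 < x < shrink s c 0.
Proof.
have [s0 lt1 lt0] := inside.
move/itvccE => hx.
have [h1|h1] := leP x (shrink s c 1); first by left; left; apply/itvccE; lra.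
have [h2|h2] := leP (shrink s c 0) x; first by left; right; apply/itvccE; lra.
by right; lra.
Qed.

Lemma fundom0 : fundom s c 0.
Proof.
have [s0 lt1 lt0] := inside.
by left; apply/itvccE; lra. Qed.
Lemma fundom1 : fundom s c 1.
Proof.
have [s0 lt1 lt0] := inside.
by right; apply/itvccE; lra. Qed.

Lemma fundom_shrink0 : fundom s c (shrink s c 0).
Proof.
have [s0 lt1 lt0] := inside.
by right; apply/itvccE; lra. Qed.
Lemma fundom_shrink1 : fundom s c (shrink s c 1).
Proof.
have [s0 lt1 lt0] := inside.
by left; apply/itvccE; lra. Qed.

Lemma fundom_shrink x : `[0, 1] x -> fundom s c (shrink s c x) -> x = 0 \/ x = 1.
Proof.
have [s0 lt1 lt0] := inside.
move=> hx; have h := shrink_itv _ hx.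
by case=> /itvccE h'; [right|left]; apply: shrink_inj; lra.
Qed.

(** A scale-invariant estimate at [c] only needs to be checked on [fundom], where
    the distance to [c] is bounded below. *)
Lemma fundom_far x : fundom s c x -> s * Num.min c (1 - c) <= `|x - c|.
Proof.
have [s0 lt1 lt0] := inside.
have [c0 c1 _] := scale_bounds.
have h1 : Num.min c (1 - c) <= c by rewrite ge_min lexx.
have h2 : Num.min c (1 - c) <= 1 - c by rewrite ge_min lexx orbT.
case=> /itvccE /andP[h3 h4].
- have := ler_wpM2l (ltW s0) h2; move: h4; rewrite /shrink => h4 h5.
  have h6 : 0 <= s * (1 - c) by apply: mulr_ge0; lra.
  by rewrite ler0_norm; lra.
- have := ler_wpM2l (ltW s0) h1; move: h3; rewrite /shrink => h3 h5.
  have h6 : 0 <= s * c by apply: mulr_ge0; lra.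
  by rewrite ger0_norm; lra.
Qed.

Lemma gap_gt0 : 0 < s * Num.min c (1 - c).
Proof.
have [s0 lt1 lt0] := inside.
have [c0 c1 _] := scale_bounds; apply: mulr_gt0 => //.
by rewrite lt_min; lra. Qed.

Lemma fundom_neqc x : fundom s c x -> x != c.
Proof.
have [s0 lt1 lt0] := inside.
move=> /fundom_far h; apply/negP => /eqP e; move: h.
by rewrite e subrr normr0 leNgt gap_gt0.
Qed.

Lemma shrink_neqc x : x != c -> shrink s c x != c.
Proof.
have [s0 lt1 lt0] := inside.
by apply: contra => /eqP h; apply/eqP/shrink_inj; rewrite h shrink_c. Qed.

(** Each point other than [c] has a finite level, the number of times that
    [shrink] can be undone before the gap set is reached: undoing it multiplies the
    distance to [c] by [1/s > 1].  The lemma is induction on the level. *)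
Lemma level_ind (P : R -> Prop) :
  (forall x, fundom s c x -> P x) ->
  (forall x, `[0, 1] x -> x != c -> P x -> P (shrink s c x)) ->
  forall x, `[0, 1] x -> x != c -> P x.
Proof.
have [s0 lt1 lt0] := inside.
move=> PA PS x hx xc.
have [c0 c1 s1] := scale_bounds.
have [n] : exists n, s ^+ n < `|x - c|.
  by apply: exists_expr_lt; [lra|rewrite normr_gt0 subr_eq0].
elim: n x hx xc => [|n IH] x hx xc hn.
  move/itvccE: hx => hx; move: hn; rewrite expr0 ltNge => /negP[].
  by rewrite ler_norml; lra.
case: (fundom_or_shrink _ hx) => [|h]; first exact: PA.
have [|x' hx' ex] := @shrink_surj x; first by lra.
have x'c : x' != c by apply: contra xc => /eqP e; rewrite ex e shrink_c.
rewrite ex; apply: PS => //; apply: IH => //.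
move: hn; rewrite exprS ex {1}/shrink.
have -> : c - s * (x' - c) - c = - (s * (x' - c)) by ring.
by rewrite normrN normrM (gtr0_norm s0) ltr_pM2l.
Qed.

End Domain.
End ScaledSelfSimilarity.

(** * Self-similar extensions *)

Section Extension.
Context {R : realType}.
Implicit Types (x y : R) (T phi f : R -> R).

(** Since [shrink] fixes [c], the value at [c] is a fixed point of [T], which
    determines it when [T] is affine of slope different from 1. *)
Definition selfsim (s c : R) T phi f :=
  (forall x, fundom s c x -> f x = phi x) /\
  (forall x, `[0, 1] x -> f (shrink s c x) = T (f x)).

(** The construction of [calG_graph] with an arbitrary rescaling of the values, so
    that it yields the map and its derivative alike. *)
Definition ext_graph (s c : R) T (v : R) phi : set (R * R) :=
  (c, v) |` \bigcup_m (iter m (fun p => (shrink s c p.1, T p.2)) @`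
                       graph_on (fundom s c) phi).

Variables (s c : R) (T : R -> R) (v : R) (phi : R -> R).
Hypothesis inside : shrinks_inside s c.
Hypothesis Tv : T v = v.
Hypothesis match0 : phi (shrink s c 0) = T (phi 0).
Hypothesis match1 : phi (shrink s c 1) = T (phi 1).

Let E := ext_graph s c T v phi.

Lemma ext_graph_fundom x : fundom s c x -> E (x, phi x).
Proof. by move=> Ax; right; exists 0%N => //; exists (x, phi x). Qed.

Lemma ext_graph_shrink x y : E (x, y) -> E (shrink s c x, T y).
Proof.
case=> [[-> ->]|[m _ [p Ap /= e]]]; first by left; rewrite shrink_c Tv.
by right; exists m.+1 => //; exists p => //=; rewrite e.
Qed.

Lemma ext_graph_inv x y : E (x, y) ->
  [\/ x = c /\ y = v,
      fundom s c x /\ y = phi x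
    | exists x' y', [/\ x = shrink s c x', y = T y' & E (x', y')] ].
Proof.
case=> [[-> ->]|[[|m] _ [p Ap /= e]]]; first by constructor 1.
  by constructor 2; move: Ap; rewrite e.
constructor 3; move: e; case e' : (iter m _ p) => [x' y'] /= [<- <-].
by exists x', y'; split=> //; right; exists m => //; exists p.
Qed.

Lemma ext_graph_unit x y : E (x, y) -> `[0, 1] x.
Proof.
have [c0 c1 _] := scale_bounds _ _ inside.
case=> [[-> _]|[m _ [[a b] [/= Aa _] e]]]; first by apply/itvccE; lra.
elim: m x y e => [|m IH] x y /= e.
  by case: e => <- _; exact: (fundom_unit _ _ inside).
case e' : (iter m _ (a, b)) e => [x' y'] /= [<- _].
exact/(shrink_unit _ _ inside)/(IH _ _ e').
Qed.

Lemma ext_graph_end e y : e = 0 \/ e = 1 -> E (e, y) -> y = phi e.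
Proof.
have [s0 lt1 lt0] := inside; have [c0 c1 _] := scale_bounds _ _ inside.
move=> he /ext_graph_inv[[ec _]|[_ //]|[x' [y' [ex _ /ext_graph_unit hx']]]].
  by exfalso; case: he; lra.
have := shrink_itv _ _ inside _ hx'; rewrite -ex => h.
by exfalso; case: he => he; lra.
Qed.

Lemma match_end e : e = 0 \/ e = 1 -> phi (shrink s c e) = T (phi e).
Proof. by case=> ->. Qed.

Lemma ext_graph_fundom_inv x y : fundom s c x -> E (x, y) -> y = phi x.
Proof.
move=> Ax /ext_graph_inv[[xc _]|[_ //]|[x' [y' [ex -> Exy]]]].
  by have := fundom_neqc _ _ inside _ Ax; rewrite xc eqxx.
have he : x' = 0 \/ x' = 1.
  by apply: (fundom_shrink _ _ inside); [exact: ext_graph_unit Exy|rewrite -ex].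
by rewrite (ext_graph_end _ _ he Exy) -match_end// ex.
Qed.

Lemma ext_graph_shrink_inv x y : `[0, 1] x -> E (shrink s c x, y) ->
  exists2 y', E (x, y') & y = T y'.
Proof.
move=> hx /ext_graph_inv[[xc ->]|[Ax ->]|[x' [y' [ex -> Exy]]]].
- exists v => //; have -> : x = c by apply: (shrink_inj _ _ inside); rewrite shrink_c.
  by left.
- have he := fundom_shrink _ _ inside _ hx Ax; exists (phi x); last exact: match_end.
  by apply: ext_graph_fundom; case: he => ->; [apply: fundom0|apply: fundom1].
- by exists y' => //; rewrite (shrink_inj _ _ inside _ _ ex).
Qed.

Lemma ext_graph_c y : E (c, y) -> y = v.
Proof.
case=> [[]//|[m _ [[a b] [/= Aa _] e]]]; exfalso.
have ac := fundom_neqc _ _ inside _ Aa.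
have : iter m (shrink s c) a = c.
  rewrite -[RHS]/(c, y).1 -e; elim: m {e} => //= m ->.
  by [].
move/eqP; rewrite -subr_eq0 iter_shrinkB mulf_eq0 expf_eq0 oppr_eq0 subr_eq0.
have [s0 _ _] := inside.
by rewrite (negbTE ac) orbF (gt_eqF s0) andbF.
Qed.

(** Neighbouring levels meet exactly at the points [shrink 0] and [shrink 1],
    where the matching conditions make the two values agree. *)
Lemma ext_graph_uniq x y y' : `[0, 1] x -> E (x, y) -> E (x, y') -> y = y'.
Proof.
move=> hx; have [->|xc] := eqVneq x c.
  by move=> /ext_graph_c-> /ext_graph_c->.
move: x hx xc y y'; apply: (level_ind _ _ inside).
  by move=> x Ax y y' /ext_graph_fundom_inv -> // /ext_graph_fundom_inv ->.
move=> x hx xc IH y y' /(ext_graph_shrink_inv _ _ hx)[z Ez ->].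
by move=> /(ext_graph_shrink_inv _ _ hx)[z' Ez' ->]; rewrite (IH _ _ Ez Ez').
Qed.

Lemma ext_graph_total x : `[0, 1] x -> exists y, E (x, y).
Proof.
move=> hx; have [->|xc] := eqVneq x c; first by exists v; left.
move: x hx xc; apply: (level_ind _ _ inside).
  by move=> x Ax; exists (phi x); exact: ext_graph_fundom.
by move=> x _ _ [y Exy]; exists (T y); exact: ext_graph_shrink.
Qed.

Lemma ext_selfsim (f := fun x => xget 0 [set y | E (x, y)]) :
  selfsim s c T phi f /\ graph_on `[0, 1] f = E.
Proof.
have fE x : `[0, 1] x -> E (x, f x).
  by move=> hx; have := xgetPex 0 (ext_graph_total _ hx).
split; first split.
- move=> x Ax; apply: ext_graph_fundom_inv => //; apply: fE.
  exact: (fundom_unit _ _ inside).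
- move=> x hx; apply: (ext_graph_uniq (shrink s c x)).
  + exact: (shrink_unit _ _ inside).
  + exact/fE/(shrink_unit _ _ inside).
  + exact/ext_graph_shrink/fE.
- apply/seteqP; split=> -[x y] /=; first by case=> /= hx ->; exact: fE.
  move=> Exy; have hx := ext_graph_unit _ _ Exy; split=> //=.
  exact: (ext_graph_uniq x _ _ hx Exy (fE _ hx)).
Qed.

End Extension.

(** * Derivatives relative to a set *)

Section DerivWithin.
Context {R : realType}.
Implicit Types (A B : set R) (f : R -> R) (x d : R).

Lemma has_deriv_withinP A f x d : has_deriv_within A f x d <->
  forall e, 0 < e -> exists2 r, 0 < r & forall y, A y -> `|y - x| < r ->
    `|f y - f x - d * (y - x)| <= e * `|y - x|.
Proof.
split.
  move=> /cvgrPdist_le h e e0; have := h e e0.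
  rewrite near_withinE /prop_near1 /dnbhs /within /= => /nbhs_ballP[r /= r0 hr].
  exists r => // y Ay yx; have [->|yNx] := eqVneq y x.
    by rewrite !subrr mulr0 subrr normr0 mulr0.
  have := hr y; rewrite /ball /= distrC => /(_ yx yNx Ay).
  have yx0 : y - x != 0 by rewrite subr_eq0.
  rewrite -(ler_pM2r (x := `|y - x|)) ?normr_gt0// -normrM mulrBl divfK//.
  by rewrite distrC.
move=> h; apply/cvgrPdist_le => e e0; have [r r0 hr] := h e e0.
rewrite near_withinE /prop_near1 /dnbhs /within /=; apply/nbhs_ballP.
exists r => // y; rewrite /ball /= distrC => yx yNx Ay.
have yx0 : y - x != 0 by rewrite subr_eq0.
rewrite -(ler_pM2r (x := `|y - x|)) ?normr_gt0// -normrM mulrBl divfK//.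
by rewrite distrC; exact: hr.
Qed.

Lemma has_deriv_withinS {A} B f x d : A `<=` B ->
  has_deriv_within B f x d -> has_deriv_within A f x d.
Proof.
move=> AB /has_deriv_withinP h; apply/has_deriv_withinP => e /h[r r0 hr].
by exists r => // y /AB; exact: hr.
Qed.

Lemma has_deriv_withinU A B f x d : has_deriv_within A f x d ->
  has_deriv_within B f x d -> has_deriv_within (A `|` B) f x d.
Proof.
move=> /has_deriv_withinP hA /has_deriv_withinP hB.
apply/has_deriv_withinP => e e0.
have [r r0 hr] := hA e e0; have [r' r'0 hr'] := hB e e0.
exists (Num.min r r'); first by rewrite lt_min r0.
by move=> y [Ay|By]; rewrite lt_min => /andP[h h']; [apply: hr|apply: hr'].
Qed.

Lemma has_deriv_within_far A f x d (r : R) : 0 < r ->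
  (forall y, A y -> r <= `|y - x|) -> has_deriv_within A f x d.
Proof.
move=> r0 h; apply/has_deriv_withinP => e e0; exists r => // y /h.
by rewrite leNgt => /negbTE->.
Qed.

Lemma eq_has_deriv_within {A} f g x d : {in A, f =1 g} -> A x ->
  has_deriv_within A f x d -> has_deriv_within A g x d.
Proof.
move=> fg Ax /has_deriv_withinP h; apply/has_deriv_withinP => e /h[r r0 hr].
by exists r => // y Ay; rewrite -!fg ?inE//; exact: hr.
Qed.

Lemma klipschitz_continuous_within A f (K : R) :
  (forall x y, A x -> A y -> `|f x - f y| <= K * `|x - y|) ->
  {within A, continuous f}.
Proof.
move=> h; apply/subspace_continuousP => x Ax; apply/cvgrPdist_le => e e0.
rewrite near_withinE /prop_near1; apply/nbhs_ballP.
have K1 : 0 < `|K| + 1 by rewrite ltr_pwDr.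
exists (e / (`|K| + 1)); first exact: divr_gt0.
move=> y; rewrite /ball /= ltr_pdivlMr// => xy Ay.
apply: le_trans (h _ _ Ax Ay) _; rewrite mulrC; apply: le_trans (ltW xy).
by rewrite ler_wpM2l// (le_trans (ler_norm K))// lerDl.
Qed.

Lemma lipschitzP A f : [lipschitz f x | x in A] <->
  exists2 K : R, 0 <= K & forall x y, A x -> A y -> `|f x - f y| <= K * `|x - y|.
Proof.
split.
  move=> [M [_ hM]]; exists (`|M| + 1); first by rewrite addr_ge0.
  have MM : M < `|M| + 1 by rewrite (le_lt_trans (ler_norm M))// ltrDl.
  by move=> x y Ax Ay; have := hM _ MM (x, y); exact.
move=> [K K0 h]; exists K; split; first exact: num_real.
move=> M KM [x y] /= [Ax Ay]; apply: le_trans (h _ _ Ax Ay) _.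
by rewrite ler_wpM2r// ltW.
Qed.

(** A one-sided derivative at an end of a segment on which [f] is affine is the
    slope of [f] there. *)
Lemma has_deriv_within_affine A f (e p a d : R) : p != e ->
  (forall t, 0 <= t <= 1 -> A (e + t * (p - e))) ->
  (forall t, 0 <= t <= 1 -> f (e + t * (p - e)) = f e + a * (t * (p - e))) ->
  has_deriv_within A f e d -> d = a.
Proof.
move=> pe hA hf /has_deriv_withinP h; apply/eqP; rewrite -subr_eq0 -normr_le0.
apply/ler_addgt0Pr => eps eps0; rewrite add0r; have [r r0 hr] := h eps eps0.
have pe0 : 0 < `|p - e| by rewrite normr_gt0 subr_eq0.
(* The factor 1/2 makes the test point lie strictly within distance r of e. *)
pose t := Num.min 1 (r / `|p - e| / 2).
have t0 : 0 < t by rewrite /t lt_min ltr01 !divr_gt0.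
have t1 : 0 <= t <= 1 by rewrite (ltW t0)/= /t ge_min lexx.
have tr : t * `|p - e| < r.
  rewrite -ltr_pdivlMr//.
  apply: (@le_lt_trans _ _ (r / `|p - e| / 2)); first by rewrite /t ge_min lexx orbT.
  by rewrite ltr_pdivrMr// ltr_pMr ?ltr1n// divr_gt0.
have := hr _ (hA t t1); rewrite hf// [e + _]addrC addrK.
have -> : f e + a * (t * (p - e)) - f e - d * (t * (p - e)) =
  (a - d) * (t * (p - e)) by ring.
rewrite [in X in X -> _]normrM (gtr0_norm t0) => /(_ tr).
rewrite normrM normrM (gtr0_norm t0) ler_pM2r ?mulr_gt0//.
by rewrite distrC.
Qed.

End DerivWithin.

(** * Regularity of self-similar maps *)

Local Notation scaling v q := (fun y => v + q * (y - v)).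

Section Scaling.
Context {R : realType}.

Lemma normD_same_sign (a b : R) : 0 <= a * b -> `|a + b| = `|a| + `|b|.
Proof.
move=> pos; apply/eqP; rewrite -(@eqrXn2 _ 2)// ?addr_ge0// -normrX sqrrD ger0_norm.
  by rewrite sqrrD -!normrX -normrM !ger0_norm// ?sqr_ge0.
by rewrite !addr_ge0 ?sqr_ge0// mulrn_wge0.
Qed.

Variables (s c : R).
Hypothesis inside : shrinks_inside s c.
Implicit Types (x y : R) (f phi : R -> R).

Lemma fundom_cover : `[0, 1] `<=` fundom s c `|` (shrink s c @` `[0, 1]).
Proof.
move=> x /(fundom_or_shrink _ _ inside)[Ax|/andP[/ltW h /ltW h']]; first by left.
have [|x' hx' ->] := shrink_surj _ _ inside x; first by rewrite h.
by right; exists x'.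
Qed.

Lemma selfsim_ends T phi f : selfsim s c T phi f ->
  forall x, fundom s c x -> forall x', `[0, 1] x' -> x = shrink s c x' ->
  phi x = T (phi x').
Proof.
move=> [fA fS] x Ax x' hx' ex; rewrite -fA// ex fS// fA//.
have := fundom_shrink _ _ inside _ hx'; rewrite -ex => /(_ Ax)[]->.
  exact: fundom0.
exact: fundom1.
Qed.

(** Both sides of the bound are multiplied by [s ^+ k] when the level increases by
    one, so a bound on [fundom] is enough. *)
Lemma selfsim_flat (k : nat) (q : R) v phi f : `|q| = s ^+ k ->
  selfsim s c (scaling v q) phi f -> f c = v ->
  forall M, (forall x, fundom s c x -> `|phi x - v| <= M) ->
  exists2 K, 0 <= K & forall x, `[0, 1] x -> `|f x - v| <= K * `|x - c| ^+ k.
Proof.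
move=> qs [fA fS] fc M hM; have [s0 _ _] := inside.
pose r := (s * Num.min c (1 - c)) ^+ k.
have r0 : 0 < r by rewrite exprn_gt0// gap_gt0.
have M0 : 0 <= M by apply: le_trans (hM _ (fundom0 _ _ inside)).
have Mr : 0 <= M / r by apply: divr_ge0 => //; exact: ltW.
exists (M / r) => // x hx; have [->|xc] := eqVneq x c.
  by rewrite fc (subrr v) normr0 mulr_ge0// exprn_ge0.
move: x hx xc; apply: (level_ind _ _ inside) => [x Ax|x hx xc IH].
  rewrite fA//; apply: le_trans (hM _ Ax) _.
  rewrite -mulrA ler_peMr// mulrC ler_pdivlMr// mul1r.
  by rewrite lerXn2r ?nnegrE// ?(fundom_far _ _ inside)// ltW// gap_gt0.
rewrite fS// [v + _]addrC addrK normrM qs /shrink.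
have -> : c - s * (x - c) - c = - (s * (x - c)) by ring.
rewrite normrN normrM (gtr0_norm s0) exprMn mulrCA ler_pM2l//.
by rewrite exprn_gt0.
Qed.

Lemma fix_affine (q v y : R) : q != 1 -> v + q * (y - v) = y -> y = v.
Proof.
move=> q1 h; apply/eqP; rewrite -subr_eq0.
have : (1 - q) * (y - v) = y - (v + q * (y - v)) by ring.
rewrite h subrr.
by move/eqP; rewrite mulf_eq0 [1 - q == 0]subr_eq0 [1 == q]eq_sym (negbTE q1).
Qed.

Lemma selfsim_c q v phi f : q != 1 ->
  selfsim s c (scaling v q) phi f -> f c = v.
Proof.
have [c0 c1 _] := scale_bounds _ _ inside.
move=> q1 [_ fS]; apply: (@fix_affine q) => //.
by rewrite -fS ?shrink_c//; apply/itvccE; lra.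
Qed.

Section Derivative.
Variables (phi dphi f df : R -> R).
Hypothesis fsim : selfsim s c (scaling 1 (s ^+ 2)) phi f.
Hypothesis dfsim : selfsim s c (scaling 0 (- s)) dphi df.

Lemma s_bounds : [/\ 0 < s, s < 1, s ^+ 2 != 1 & - s != 1].
Proof.
have [s0 _ _] := inside; have [_ _ s1] := scale_bounds _ _ inside; split=> //.
  by rewrite lt_eqF// expr_lt1// ltW.
by rewrite lt_eqF//; lra.
Qed.

Lemma selfsim_fc : f c = 1.
Proof. by have [_ _ s2 _] := s_bounds; exact: selfsim_c fsim. Qed.

Lemma selfsim_dfc : df c = 0.
Proof. by have [_ _ _ s2] := s_bounds; exact: selfsim_c dfsim. Qed.

Lemma selfsim_range : phi @` fundom s c `<=` `[0, 1] -> f @` `[0, 1] `<=` `[0, 1].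
Proof.
have [s0 s1 _ _] := s_bounds; have [fA fS] := fsim.
move=> hphi _ [x hx <-]; have [->|xc] := eqVneq x c.
  by rewrite selfsim_fc; apply/itvccE; lra.
move: x hx xc; apply: (level_ind _ _ inside) => [x Ax|x hx xc /itvccE IH].
  by rewrite fA//; apply: hphi; exists x.
rewrite fS//; apply/itvccE.
have : 0 <= s ^+ 2 * f x by rewrite mulr_ge0 ?sqr_ge0//; lra.
have : 0 <= s ^+ 2 * (1 - f x) by rewrite mulr_ge0 ?sqr_ge0//; lra.
have : s ^+ 2 <= 1 by rewrite expr_le1// ltW.
by lra.
Qed.

Lemma selfsim_df_neq0 : (forall x, fundom s c x -> dphi x != 0) ->
  forall x, `[0, 1] x -> df x = 0 <-> x = c.
Proof.
have [s0 s1 _ _] := s_bounds; have [dfA dfS] := dfsim.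
move=> h x hx; split=> [/eqP|->]; last exact: selfsim_dfc.
move=> dfx; apply/eqP; apply: contraTT dfx.
move: x hx; apply: (level_ind _ _ inside) => [x Ax|x hx xc IH].
  by rewrite dfA// h.
by rewrite dfS// add0r subr0 mulf_neq0// oppr_eq0 gt_eqF.
Qed.

(** The chain rule for [f (shrink x) = 1 + s^2 (f x - 1)]: the value is scaled by
    [s^2] and the variable by [- s]. *)
Lemma deriv_shrink x d : has_deriv_within `[0, 1] f x d -> `[0, 1] x ->
  has_deriv_within (shrink s c @` `[0, 1]) f (shrink s c x) (- s * d).
Proof.
have [s0 s1 _ _] := s_bounds; have [_ fS] := fsim.
move=> /has_deriv_withinP h hx; apply/has_deriv_withinP => e e0.
have [r r0 hr] := h (e / s) (divr_gt0 e0 s0).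
exists (s * r); first exact: mulr_gt0.
move=> _ [y hy <-].
have -> : shrink s c y - shrink s c x = - s * (y - x) by rewrite /shrink; ring.
rewrite normrM normrN (gtr0_norm s0) ltr_pM2l// => yx.
rewrite !fS//.
have -> : 1 + s ^+ 2 * (f y - 1) - (1 + s ^+ 2 * (f x - 1)) - - s * d * (- s * (y - x))
  = s ^+ 2 * (f y - f x - d * (y - x)) by ring.
rewrite normrM ger0_norm ?sqr_ge0//.
have -> : e * (s * `|y - x|) = s ^+ 2 * (e / s * `|y - x|).
  by field; rewrite gt_eqF.
by rewrite ler_pM2l ?exprn_gt0//; exact: hr.
Qed.

Hypothesis phiD : forall x, fundom s c x -> has_deriv_within (fundom s c) phi x (dphi x).

Lemma selfsim_deriv_fundom x : fundom s c x -> has_deriv_within (fundom s c) f x (dphi x).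
Proof.
have [fA _] := fsim; move=> Ax; apply: eq_has_deriv_within Ax (phiD _ Ax).
by move=> y; rewrite inE => /fA.
Qed.

(** The points 0 and 1 lie away from [I_2], so that [f] agrees with [phi] near
    them. *)
Lemma selfsim_deriv_end e : e = 0 \/ e = 1 -> has_deriv_within `[0, 1] f e (dphi e).
Proof.
move=> he; have Ae : fundom s c e by case: he => ->; [apply: fundom0|apply: fundom1].
apply: has_deriv_withinS fundom_cover _; apply: has_deriv_withinU.
  exact: selfsim_deriv_fundom.
have [s0 lt1 lt0] := inside.
apply: (@has_deriv_within_far _ _ _ _ _ (Num.min (shrink s c 1) (1 - shrink s c 0))).
  by rewrite lt_min; lra.
move=> _ [y /(shrink_itv _ _ inside) hy <-].
case: he => ->.
  rewrite subr0 ger0_norm; last by lra.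
  by rewrite ge_min; apply/orP; left; lra.
rewrite ler0_norm; last by lra.
by rewrite ge_min; apply/orP; right; lra.
Qed.

(** At an interior point of a level only one branch matters.  At the two ends of
    [I_2] the branch coming from [phi] and the branch coming from
    [shrink @` `[0, 1]] meet, and their one-sided derivatives agree since [df]
    solves its own functional equation. *)
Lemma selfsim_deriv_neqc x : `[0, 1] x -> x != c -> has_deriv_within `[0, 1] f x (df x).
Proof.
have [dfA dfS] := dfsim.
have onA y : fundom s c y -> has_deriv_within `[0, 1] f y (df y).
  move=> Ay; rewrite dfA//.
  apply: has_deriv_withinS fundom_cover _; apply: has_deriv_withinU.
    exact: selfsim_deriv_fundom.
  have [hy|hy] := pselect ((shrink s c @` `[0, 1]) y).
    case: hy => e he ey.
    rewrite (selfsim_ends _ _ _ dfsim _ Ay _ he (esym ey)) add0r subr0 -ey.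
    apply: deriv_shrink => //; apply: selfsim_deriv_end.
    by apply: (fundom_shrink _ _ inside) => //; rewrite ey.
  have farE z : (shrink s c @` `[0, 1]) z -> shrink s c 1 <= z <= shrink s c 0.
    by case=> t ht <-; exact: shrink_itv.
  have yE : ~~ (shrink s c 1 <= y <= shrink s c 0).
    by apply/negP => /(shrink_surj _ _ inside)[y' hy' ey]; apply: hy; exists y'.
  have s01 : shrink s c 1 < shrink s c 0 by have [s0 _ _] := inside; rewrite /shrink; lra.
  move: yE; rewrite negb_and -!ltNge => /orP yE.
  case: Ay => /itvccE Ay.
    have {}yE : y < shrink s c 1 by case: yE => yE; lra.
    apply: (@has_deriv_within_far _ _ _ _ _ (shrink s c 1 - y)) => [|z /farE hz].
      by lra.
    by rewrite ger0_norm; lra.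
  have {}yE : shrink s c 0 < y by case: yE => yE; lra.
  apply: (@has_deriv_within_far _ _ _ _ _ (y - shrink s c 0)) => [|z /farE hz].
    by lra.
  by rewrite ler0_norm; lra.
move: x; apply: (level_ind _ _ inside) => [|x hx xc IH]; first exact: onA.
have [Ax|NAx] := pselect (fundom s c (shrink s c x)); first exact: onA.
have [//|/andP[h1 h2]] := fundom_or_shrink _ _ inside _ (shrink_unit _ _ inside _ hx).
apply: has_deriv_withinS fundom_cover _; apply: has_deriv_withinU.
  apply: (@has_deriv_within_far _ _ _ _ _
           (Num.min (shrink s c x - shrink s c 1) (shrink s c 0 - shrink s c x))).
    by rewrite lt_min; lra.
  move=> y [] /itvccE hy; rewrite ge_min; apply/orP; [left|right].
    by rewrite ler0_norm; lra.
  by rewrite ger0_norm; lra.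
by rewrite dfS// add0r subr0; exact: deriv_shrink.
Qed.

Lemma fundom_dist1 x : fundom s c x -> `|x - 1| <= 1.
Proof. by move=> /(fundom_unit _ _ inside)/itvccE hx; rewrite ler_norml; lra. Qed.

Hypothesis phi_unit : phi @` fundom s c `<=` `[0, 1].

Lemma selfsim_quadratic : exists2 K, 0 <= K &
  forall x, `[0, 1] x -> `|f x - 1| <= K * `|x - c| ^+ 2.
Proof.
have [s0 s1 _ _] := s_bounds.
apply: (@selfsim_flat 2 (s ^+ 2) 1 phi f _ fsim selfsim_fc 1).
  by rewrite ger0_norm ?sqr_ge0.
move=> x Ax; have /itvccE h : `[0, 1] (phi x) by apply: phi_unit; exists x.
by rewrite ler_norml; lra.
Qed.

Lemma selfsim_deriv x : `[0, 1] x -> has_deriv_within `[0, 1] f x (df x).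
Proof.
move=> hx; have [->|xc] := eqVneq x c; last exact: selfsim_deriv_neqc.
rewrite selfsim_dfc; apply/has_deriv_withinP => e e0.
have [K K0 hK] := selfsim_quadratic.
have K1 : 0 < K + 1 by lra.
(* The shift by 1 covers K = 0. *)
exists (e / (K + 1)); first exact: divr_gt0.
move=> y hy yc; rewrite selfsim_fc mul0r subr0.
apply: le_trans (hK _ hy) _; rewrite expr2 mulrA ler_wpM2r//.
move: yc; rewrite ltr_pdivlMr// => /ltW; apply: le_trans.
by rewrite mulrC ler_wpM2l// lerDl.
Qed.

Variable K : R.
Hypothesis K0 : 0 <= K.
Hypothesis dphiK : forall x y, fundom s c x -> fundom s c y ->
  `|dphi x - dphi y| <= K * `|x - y|.

Lemma selfsim_df_linear : exists2 M, 0 <= M &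
  forall x, `[0, 1] x -> `|df x - 0| <= M * `|x - c| ^+ 1.
Proof.
have [s0 s1 _ _] := s_bounds.
apply: (@selfsim_flat 1 (- s) 0 dphi df _ dfsim selfsim_dfc (`|dphi 1| + K)).
  by rewrite normrN gtr0_norm.
move=> x Ax; rewrite subr0.
have -> : dphi x = dphi 1 + (dphi x - dphi 1) by ring.
apply: le_trans (ler_normD _ _) _; rewrite lerD2l.
apply: le_trans (dphiK _ _ Ax (fundom1 _ _ inside)) _.
by rewrite ler_piMr// fundom_dist1.
Qed.

Let same_side (x y : R) := 0 < (x - c) * (y - c).

Lemma shrink_same_side x y :
  same_side (shrink s c x) (shrink s c y) = same_side x y.
Proof.
have [s0 _ _ _] := s_bounds; rewrite /same_side /shrink.
have -> : (c - s * (x - c) - c) * (c - s * (y - c) - c) =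
  s ^+ 2 * ((x - c) * (y - c)) by ring.
by rewrite pmulr_rgt0// exprn_gt0.
Qed.

(** [df] scales by [- s] just as distances do, so the Lipschitz quotient is the
    same at all levels. *)
Lemma selfsim_df_lip_shrink x y : `|df x - df y| <= K * `|x - y| ->
  `[0, 1] x -> `[0, 1] y ->
  `|df (shrink s c x) - df (shrink s c y)| <= K * `|shrink s c x - shrink s c y|.
Proof.
have [s0 _ _ _] := s_bounds; have [_ dfS] := dfsim.
move=> h hx hy; rewrite !dfS// /shrink.
have -> : 0 + - s * (df x - 0) - (0 + - s * (df y - 0)) = - (s * (df x - df y)).
  by ring.
have -> : c - s * (x - c) - (c - s * (y - c)) = - (s * (x - y)) by ring.
by rewrite !normrN !normrM (gtr0_norm s0) mulrCA ler_pM2l.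
Qed.

(** A segment from [fundom] to a deeper level crosses the end of [I_2] lying on
    its side of [c]; that end belongs to [fundom] and is the image of 0 or 1, so
    the part beyond it is one level less deep. *)
Lemma selfsim_df_lip_fundom y : `[0, 1] y -> y != c ->
  forall x, fundom s c x -> same_side x y -> `|df x - df y| <= K * `|x - y|.
Proof.
have [s0 lt1 lt0] := inside; have [dfA dfS] := dfsim.
have [c0 c1 s1] := scale_bounds _ _ inside.
have lipA x z : fundom s c x -> fundom s c z -> `|df x - df z| <= K * `|x - z|.
  by move=> Ax Az; rewrite !dfA//; exact: dphiK.
move: y; apply: (level_ind _ _ inside) => [y Ay x Ax _|y hy yc IH x Ax xy].
  exact: lipA.
have hs := shrink_itv _ _ inside _ hy.
(* The junction is the end shrink e of I_2 that separates x from shrink y. *)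
have via e : e = 0 \/ e = 1 -> same_side e y -> fundom s c (shrink s c e) ->
    0 <= (x - shrink s c e) * (shrink s c e - shrink s c y) ->
    `|df x - df (shrink s c y)| <= K * `|x - shrink s c y|.
  move=> he ey Ase pos.
  have Ae : fundom s c e by case: he => ->; [apply: fundom0|apply: fundom1].
  have h1 := lipA _ _ Ax Ase.
  have h2 := selfsim_df_lip_shrink _ _ (IH _ Ae ey) (fundom_unit _ _ inside _ Ae) hy.
  have -> : x - shrink s c y = (x - shrink s c e) + (shrink s c e - shrink s c y) by ring.
  have -> : `|x - shrink s c e + (shrink s c e - shrink s c y)| =
      `|x - shrink s c e| + `|shrink s c e - shrink s c y|.
    exact: normD_same_sign.
  have -> : df x - df (shrink s c y) =
    (df x - df (shrink s c e)) + (df (shrink s c e) - df (shrink s c y)) by ring.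
  by rewrite mulrDr; apply: le_trans (ler_normD _ _) _; exact: lerD.
have e1 : shrink s c 0 = c + s * c by rewrite /shrink; ring.
have e2 : shrink s c 1 = c - s * (1 - c) by rewrite /shrink; ring.
have sc0 : 0 < s * c by apply: mulr_gt0.
have sc1 : 0 < s * (1 - c) by apply: mulr_gt0; lra.
have [xc|xc] := ltP x c.
- have xs : x <= shrink s c 1 by case: Ax => /itvccE; lra.
  have ys : shrink s c y - c < 0.
    by move: xy; rewrite /same_side nmulr_rgt0//; lra.
  have yc' : 0 < y - c by move: ys; rewrite /shrink addrAC subrr add0r oppr_lt0 pmulr_rgt0.
  apply: (via 1); [by right| |exact: fundom_shrink1|].
    by rewrite /same_side mulr_gt0//; lra.
  by rewrite mulr_le0//; lra.
- have xs : shrink s c 0 <= x by case: Ax => /itvccE; lra.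
  have ys : 0 < shrink s c y - c.
    by move: xy; rewrite /same_side pmulr_rgt0//; lra.
  have yc' : y - c < 0 by move: ys; rewrite /shrink addrAC subrr add0r oppr_gt0 pmulr_rlt0.
  apply: (via 0); [by left| |exact: fundom_shrink0|].
    by rewrite /same_side nmulr_rgt0//; lra.
  by rewrite mulr_ge0//; lra.
Qed.

Lemma selfsim_df_lip_side x : `[0, 1] x -> x != c ->
  forall y, `[0, 1] y -> same_side x y -> `|df x - df y| <= K * `|x - y|.
Proof.
have sideC a b : same_side a b = same_side b a by rewrite /same_side mulrC.
have neqc a b : same_side a b -> b != c.
  move=> h; apply/eqP => bc; move: h.
  by rewrite /same_side bc subrr mulr0 ltxx.
move: x; apply: (level_ind _ _ inside) => [x Ax y hy xy|x hx xc IH y hy xy].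
  by apply: selfsim_df_lip_fundom => //; exact: neqc xy.
case: (fundom_cover _ hy) => [Ay|[y' hy' ey]].
  rewrite distrC [X in K * X]distrC; apply: selfsim_df_lip_fundom => //.
  - exact: shrink_unit.
  - exact: shrink_neqc.
  - by rewrite sideC.
rewrite -ey; apply: selfsim_df_lip_shrink => //; apply: IH => //.
by move: xy; rewrite -ey shrink_same_side.
Qed.

(** Two points on opposite sides of [c] are compared through [c], where [df]
    vanishes linearly. *)
Lemma selfsim_df_lip : [lipschitz df x | x in `[0, 1]].
Proof.
have [M M0 hM] := selfsim_df_linear.
apply/lipschitzP; exists (K + M); first exact: addr_ge0.
move=> x y hx hy; rewrite mulrDl.
have [xy|xy] := ltP 0 ((x - c) * (y - c)).
  have xc : x != c.
    by apply/eqP => xc; move: xy; rewrite xc subrr mul0r ltxx.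
  apply: le_trans (selfsim_df_lip_side _ hx xc _ hy xy) _.
  by rewrite lerDl mulr_ge0.
have h : `|x - c| + `|y - c| = `|x - y|.
  have -> : x - y = (x - c) + (c - y) by ring.
  rewrite [`|y - c|]distrC.
  have pos : 0 <= (x - c) * (c - y) by rewrite -[c - y]opprB mulrN oppr_ge0.
  by rewrite (normD_same_sign _ _ pos).
have := hM _ hx; have := hM _ hy; rewrite !subr0 !expr1 => h1 h2.
apply: le_trans (ler_normB _ _) _.
apply: le_trans (lerD h2 h1) _.
by rewrite -mulrDr h lerDr mulr_ge0.
Qed.

Lemma selfsim_C1Lip : C1Lip_on `[0, 1] f df.
Proof.
have lip := selfsim_df_lip; split=> //; split; first exact: selfsim_deriv.
have [L _ hL] := (lipschitzP _ _).1 lip.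
exact: klipschitz_continuous_within hL.
Qed.

End Derivative.
End Scaling.

(** * The maps of the theorem *)

#[local] Arguments ui : simpl never.

Section Cstar.
Context {R : realType}.
Variable c : R.
Hypothesis cstar : is_cstar c.

(** The length [s_2] of [I_2], which is the contraction factor. *)
Definition ratio (c : R) : R := ui c 8 - ui c 3.

Definition tau (s y : R) : R := 1 + s ^+ 2 * (y - 1).

Local Notation s := (ratio c).

(** The equation defining [c] says that [c] is fixed by the affine map [stil c 2]
    of slope [- s_2]. *)
Lemma stil2E : stil c 2 = shrink s c.
Proof.
have [[_ [[_ h _ _ _] _]] e] := cstar.
have e8 : ui c 8 - c = c * (ui c 8 - ui c 3).
  by have := @divfK R _ (lt0r_neq0 h) (ui c 8 - c); rewrite e.
by apply/funext => x; rewrite /= /shrink /ratio; lra.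
Qed.

Lemma cstar_inside : shrinks_inside s c.
Proof.
rewrite /shrinks_inside -stil2E /=.
have [[/andP[c0 c2] [[h1 h2 h3 h4 h5] [k1 k2 k3 k4]]] _] := cstar.
by split; rewrite /ratio; lra.
Qed.

(** Since [u c] is a quadratic polynomial with critical point [c] and critical
    value 1, scaling the distance to [c] by [- s] scales the distance of the value
    to 1 by [s^2]. *)
Lemma u_shrink x : u c (shrink s c x) = tau s (u c x).
Proof.
have [c0 c1 _] := scale_bounds _ _ cstar_inside.
by rewrite /u /tau /shrink; field; lra.
Qed.

Lemma ui3E : ui c 3 = shrink s c 1. Proof. by rewrite -stil2E /=; ring. Qed.
Lemma ui8E : ui c 8 = shrink s c 0. Proof. by rewrite -stil2E /=; ring. Qed.

Lemma uiS k : u c (ui c k) = ui c k.+1. Proof. by []. Qed.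

Lemma u1 : u c 1 = 0.
Proof.
have [c0 c1 _] := scale_bounds _ _ cstar_inside.
by rewrite /u divff ?expr1n ?subrr//; lra.
Qed.

(** In particular [s_5 = s_2^2], from the value of the parabola at the end
    [u^3(0)] of [I_2]. *)
Lemma stil5E : stil c 5 = tau s.
Proof.
apply/funext => y; have := u_shrink 1; rewrite -ui3E uiS u1 /tau /= => ->.
by ring.
Qed.

Lemma AdomE : Adom c = fundom s c.
Proof. by rewrite /Adom /y1 /z1 stil2E. Qed.

Lemma stil_affine i t : stil c i t = (1 - t) * stil c i 0 + t * stil c i 1.
Proof. by case: i => [|[|[|[|[|[|i]]]]]] /=; ring. Qed.

Lemma Ipar_S i n t : Ipar c i n.+2 t = shrink s c (Ipar c i n.+1 t).
Proof. by rewrite -stil2E. Qed.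

Lemma Ipar_affine i n t :
  Ipar c i n.+1 t = (1 - t) * Ipar c i n.+1 0 + t * Ipar c i n.+1 1.
Proof.
elim: n => [|n IH]; first exact: stil_affine.
by rewrite !Ipar_S IH /shrink; ring.
Qed.

Lemma stil_fundom i t : i \in [:: 1; 3; 4; 5]%N -> `[0, 1] t ->
  fundom s c (stil c i t).
Proof.
have [[/andP[c0 c2] [[h1 h2 h3 h4 h5] [k1 k2 k3 k4]]] _] := cstar.
move=> hi /itvccE /andP[t0 t1]; rewrite /fundom -ui3E -ui8E.
have t1' : 0 <= 1 - t by lra.
move: hi; rewrite !inE => /orP[/eqP->|/orP[/eqP->|/orP[/eqP->|/eqP->]]] /=.
- have a := mulr_ge0 (ltW h1) t1'; have b := mulr_ge0 (ltW h1) t0.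
  by left; apply/itvccE; lra.
- have a := mulr_ge0 (ltW h3) t1'; have b := mulr_ge0 (ltW h3) t0.
  by right; apply/itvccE; lra.
- have a := mulr_ge0 (ltW h4) t1'; have b := mulr_ge0 (ltW h4) t0.
  by right; apply/itvccE; lra.
- have a := mulr_ge0 (ltW h5) t1'; have b := mulr_ge0 (ltW h5) t0.
  by right; apply/itvccE; lra.
Qed.

Variables (g psi : R -> R).
Hypothesis gP : is_g c g.
Hypothesis psiP : is_psi c g psi.

Lemma in_Dset i n t : i \in [:: 1; 3; 4; 5]%N -> `[0, 1] t ->
  Dset c (Ipar c i n.+1 t).
Proof.
move=> hi ht; exists n.+1 => //.
have : Iset c i n.+1 (Ipar c i n.+1 t) by exists t.
move: hi; rewrite !inE => /orP[/eqP->|/orP[/eqP->|/orP[/eqP->|/eqP->]]] h.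
- by left; left; left.
- by left; left; right.
- by left; right.
- by right.
Qed.

Lemma g_affine i n t : i \in [:: 1; 3; 4; 5]%N -> `[0, 1] t ->
  g (Ipar c i n.+1 t) =
  (1 - t) * u c (Ipar c i n.+1 0) + t * u c (Ipar c i n.+1 1).
Proof.
move=> hi ht; have [[a [b gab]] <- <-] := gP i n.+1 hi isT.
have I x : `[0, 1] x -> Iset c i n.+1 (Ipar c i n.+1 x) by move=> hx; exists x.
rewrite !gab; first by rewrite [in LHS]Ipar_affine; ring.
all: by apply: I => //; apply/itvccE; lra.
Qed.

Lemma psi_affine i t : i \in [:: 1; 3; 4; 5]%N -> `[0, 1] t ->
  psi (stil c i t) = (1 - t) * u c (stil c i 0) + t * u c (stil c i 1).
Proof.
move=> hi ht; have [_ [psig _]] := psiP.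
rewrite psig; first exact: (@g_affine i 0).
- exact: (@in_Dset i 0).
- by rewrite AdomE; exact: stil_fundom.
Qed.

Lemma psi_junction (x x' : R) : x = shrink s c x' -> x' = 0 \/ x' = 1 ->
  psi x = u c x.
Proof.
have h01 : `[0, 1] (1 : R) by apply/itvccE; lra.
have [_ [psig _]] := psiP; have H := cstar_inside.
have e0 : shrink s c 0 = Ipar c 1 2 1.
  by rewrite Ipar_S; congr shrink; rewrite /Ipar /=; ring.
have e1 : shrink s c 1 = Ipar c 5 2 1.
  by rewrite Ipar_S; congr shrink; rewrite /Ipar /=; ring.
move=> -> [->|->]; rewrite psig ?AdomE.
- by rewrite e0; have [] := gP 1 2 isT isT.
- by rewrite e0; exact: in_Dset.
- exact: fundom_shrink0.
- by rewrite e1; have [] := gP 5 2 isT isT.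
- by rewrite e1; exact: in_Dset.
- exact: fundom_shrink1.
Qed.

Lemma psi0 : psi 0 = u c 0.
Proof.
have {1}-> : 0 = stil c 1 1 by rewrite /=; ring.
rewrite psi_affine//; last by apply/itvccE; lra.
by rewrite /= !subrr !mulr0 mul0r mul1r add0r.
Qed.

Lemma psi1 : psi 1 = u c 1.
Proof.
have {1}-> : 1 = stil c 5 1 by rewrite /=; ring.
rewrite psi_affine//; last by apply/itvccE; lra.
by rewrite /= !subrr !mulr0 mul0r mul1r add0r subr0.
Qed.

Lemma psi_match0 : psi (shrink s c 0) = tau s (psi 0).
Proof. by rewrite (psi_junction _ 0)//; [rewrite u_shrink psi0|left]. Qed.

Lemma psi_match1 : psi (shrink s c 1) = tau s (psi 1).
Proof. by rewrite (psi_junction _ 1)//; [rewrite u_shrink psi1|right]. Qed.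

Section Selfsim.
Variable f : R -> R.
Hypothesis fsim : selfsim s c (tau s) psi f.

(** At level [n], both sides are images under [tau] of the same expression at
    level [n - 1]. *)
Lemma selfsim_affine i n t : i \in [:: 1; 3; 4; 5]%N -> `[0, 1] t ->
  f (Ipar c i n.+1 t) =
  (1 - t) * u c (Ipar c i n.+1 0) + t * u c (Ipar c i n.+1 1).
Proof.
have [fA fS] := fsim.
move=> hi ht; elim: n => [|n IH].
  by rewrite fA; [exact: psi_affine|exact: stil_fundom].
have unit m : `[0, 1] (Ipar c i m.+1 t).
  elim: m => [|m IHm]; first exact/(fundom_unit _ _ cstar_inside)/stil_fundom.
  by rewrite Ipar_S; apply: (shrink_unit _ _ cstar_inside).
by rewrite !Ipar_S fS// IH !u_shrink /tau; ring.
Qed.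

Lemma selfsim_Dset x : Dset c x -> f x = g x.
Proof.
case=> [[|n]]//= _; case=> [[[]|]|] [t ht <-]; rewrite selfsim_affine// g_affine//.
Qed.

(** [u c] carries the ends of [I_5, I_1, I_3, I_4] to those of [I_1, I_3, I_4,
    I_2], since they lie on the orbit of 0, except 1, which is mapped to 0; the
    orientations chosen for the [stil c i] make the affine maps between them the
    identity in the parameter. *)
Lemma selfsim_stil i j t : (i, j) \in [:: (5, 1); (1, 3); (3, 4); (4, 2)]%N ->
  `[0, 1] t -> f (stil c i t) = stil c j t.
Proof.
have e3 : stil c 3 0 = ui c 6 /\ stil c 3 1 = ui c 1 by split; rewrite /=; ring.
have e4 : stil c 4 0 = ui c 7 /\ stil c 4 1 = ui c 2 by split; rewrite /=; ring.
have e1 : stil c 1 0 = ui c 5 /\ stil c 1 1 = ui c 0 by split; rewrite /= ?/ui /=; ring.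
have e5 : stil c 5 0 = ui c 4 /\ stil c 5 1 = 1 by split; rewrite /=; ring.
have e2 : stil c 2 0 = ui c 8 /\ stil c 2 1 = ui c 3 by split; rewrite /=; ring.
move=> hij ht; rewrite -[stil c i t]/(Ipar c i 1 t) selfsim_affine//; last first.
  by move: hij; rewrite !inE => /orP[|/orP[|/orP[|]]] /eqP[-> _].
rewrite /Ipar /= [in RHS]stil_affine.
move: hij; rewrite !inE => /orP[|/orP[|/orP[|]]] /eqP[-> ->].
- by rewrite !e1.1 !e1.2 !e5.1 !e5.2 uiS u1.
- by rewrite !e1.1 !e1.2 !e3.1 !e3.2 !uiS.
- by rewrite !e3.1 !e3.2 !e4.1 !e4.2 !uiS.
- by rewrite !e4.1 !e4.2 !e2.1 !e2.2 !uiS.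
Qed.


Lemma selfsim_junction e : e = 0 \/ e = 1 -> f (shrink s c e) = u c (shrink s c e).
Proof.
move=> he; rewrite fsim.1; first exact: (psi_junction _ e).
by case: he => ->; [apply: fundom_shrink0|apply: fundom_shrink1]; exact: cstar_inside.
Qed.

Lemma selfsim_Iset_end i t : i \in [:: 1; 3; 4; 5]%N -> t = 0 \/ t = 1 ->
  f (stil c i t) = u c (stil c i t).
Proof.
move=> hi ht; have ht' : `[0, 1] t by apply/itvccE; case: ht; lra.
rewrite -[stil c i t]/(Ipar c i 1 t) selfsim_affine//.
by case: ht => ->; rewrite ?subr0 ?subrr ?mul1r ?mul0r ?addr0 ?add0r.
Qed.

Lemma critical_orbit k : (k <= 8)%N -> iter k f 0 = ui c k.
Proof.
have step m : (m <= 7)%N -> f (ui c m) = ui c m.+1.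
  have end0 : 0 = 0 :> R \/ 0 = 1 :> R by left.
  have end1 : 1 = 0 :> R \/ 1 = 1 :> R by right.
  rewrite -uiS; case: m => [|[|[|[|[|[|[|[|//]]]]]]]] _.
  - have -> : ui c 0 = stil c 1 1 by rewrite /= /ui /=; ring.
    exact: selfsim_Iset_end.
  - have -> : ui c 1 = stil c 3 1 by rewrite /=; ring.
    exact: selfsim_Iset_end.
  - have -> : ui c 2 = stil c 4 1 by rewrite /=; ring.
    exact: selfsim_Iset_end.
  - by rewrite ui3E; exact: selfsim_junction.
  - have -> : ui c 4 = stil c 5 0 by rewrite /=; ring.
    exact: selfsim_Iset_end.
  - have -> : ui c 5 = stil c 1 0 by rewrite /=; ring.
    exact: selfsim_Iset_end.
  - have -> : ui c 6 = stil c 3 0 by rewrite /=; ring.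
    exact: selfsim_Iset_end.
  - have -> : ui c 7 = stil c 4 0 by rewrite /=; ring.
    exact: selfsim_Iset_end.
elim: k => // k IH hk; rewrite iterS IH ?step//; exact: ltnW.
Qed.

Lemma renh_selfsim : renh f = shrink s c.
Proof.
apply/funext => x; rewrite /renh !critical_orbit// -stil2E /=; ring.
Qed.

Lemma selfsim_itv x : `[0, 1] x -> `[0, 1] (f x).
Proof.
have [pr _] := psiP; rewrite AdomE in pr.
move=> hx; apply: (selfsim_range _ _ cstar_inside _ _ fsim pr); by exists x.
Qed.

(** The point [shrink x] of [I_2] has image [stil c 5 (f x)] in [I_5]; afterwards
    the parameter [f x] is carried along unchanged. *)
Lemma selfsim_cycle x : `[0, 1] x ->
  [/\ iter 1 f (shrink s c x) = stil c 5 (f x),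
      iter 2 f (shrink s c x) = stil c 1 (f x),
      iter 3 f (shrink s c x) = stil c 3 (f x),
      iter 4 f (shrink s c x) = stil c 4 (f x)
    & iter 5 f (shrink s c x) = shrink s c (f x)].
Proof.
move=> hx; have hf := selfsim_itv _ hx.
have e1 : iter 1 f (shrink s c x) = stil c 5 (f x) by rewrite stil5E -fsim.2.
have e2 : iter 2 f (shrink s c x) = stil c 1 (f x).
  by rewrite iterS e1; exact: selfsim_stil.
have e3 : iter 3 f (shrink s c x) = stil c 3 (f x).
  by rewrite iterS e2; exact: selfsim_stil.
have e4 : iter 4 f (shrink s c x) = stil c 4 (f x).
  by rewrite iterS e3; exact: selfsim_stil.
by split=> //; rewrite iterS e4 -stil2E; exact: selfsim_stil.
Qed.

Lemma renorm_selfsim_eq x : `[0, 1] x -> renorm f x = f x.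
Proof.
have [s0 _ _] := cstar_inside.
move=> hx; rewrite /renorm renh_selfsim; have [_ _ _ _ ->] := selfsim_cycle x hx.
rewrite /renh_inv !critical_orbit// ui8E {1 2}/shrink.
have -> : shrink s c 0 - ui c 3 = s by rewrite -ui8E.
by field; rewrite gt_eqF.
Qed.

Lemma renorm_selfsim : selfsim s c (tau s) psi (renorm f).
Proof.
have [fA fS] := fsim; have H := cstar_inside.
split=> x hx; first by rewrite renorm_selfsim_eq ?fA//; exact: fundom_unit H _ hx.
by rewrite !renorm_selfsim_eq ?fS//; exact: shrink_unit.
Qed.

Section Derivative.
Variable df : R -> R.
Variable dpsi : R -> R.
Hypothesis dpsiP : C1Lip_on (fundom s c) psi dpsi.
Hypothesis dpsi_neq0 : forall x, fundom s c x -> dpsi x != 0.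
Hypothesis dfsim : selfsim s c (scaling 0 (- s)) dpsi df.

Lemma selfsim_psi_C1Lip : C1Lip_on `[0, 1] f df.
Proof.
have [[pd _] /lipschitzP[K K0 pK]] := dpsiP.
have [pr _] := psiP; rewrite AdomE in pr.
exact: (selfsim_C1Lip _ _ cstar_inside psi dpsi f df fsim dfsim pd pr K K0 pK).
Qed.

Lemma selfsim_unimodal : unimodal f c.
Proof.
have [c0 c1 _] := scale_bounds _ _ cstar_inside.
split.
- by apply/itvccE; lra.
- by move=> _ [x hx <-]; exact: selfsim_itv.
- exists df; first by have [] := selfsim_psi_C1Lip.
  exact: (selfsim_df_neq0 _ _ cstar_inside _ _ dfsim dpsi_neq0).
- exact: (selfsim_fc _ _ cstar_inside _ _ fsim).
- by rewrite fsim.1 ?psi1 ?u1//; exact: fundom1 cstar_inside.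
Qed.

Lemma selfsim_quint_renormalizable : quint_renormalizable f.
Proof.
have H := cstar_inside; have [s0 lt1 lt0] := H; have [c0 c1 s1] := scale_bounds _ _ H.
have [[/andP[_ _] [[h1 h2 h3 h4 h5] [k1 k2 k3 k4]]] _] := cstar.
have JE : renJ f = shrink s c @` `[0, 1].
  rewrite /renJ !critical_orbit// ui3E ui8E; apply/seteqP; split=> x.
    by move=> /itvccE /(shrink_surj _ _ H)[x' hx' ->]; exists x'.
  by case=> x' /(shrink_itv _ _ H) hx' <-; apply/itvccE.
have I2 y : renJ f y -> ui c 3 <= y <= ui c 8.
  by rewrite /renJ !critical_orbit// => /itvccE.
have I0 y : (iter 0 f @` renJ f) y -> ui c 3 <= y <= ui c 8.
  by case=> x /I2 + <-.
have bd (a b : R) : 0 < a -> `[0, 1] b -> 0 <= a * b <= a.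
  move=> a0 /itvccE /andP[b0 b1].
  by rewrite mulr_ge0 ?(ltW a0)//= ler_piMr// ltW.
have sub1 (t : R) : `[0, 1] t -> `[0, 1] (1 - t) by move=> /itvccE ?; apply/itvccE; lra.
have I5 y : (f @` renJ f) y -> ui c 4 <= y.
  rewrite JE => -[_ [x hx <-] <-]; have [/= -> _ _ _ _] := selfsim_cycle x hx.
  by have /andP[] := bd _ _ h5 (sub1 _ (selfsim_itv _ hx)); lra.
have I1 y : (iter 2 f @` renJ f) y -> y <= ui c 5.
  rewrite JE => -[_ [x hx <-] <-]; have [_ -> _ _ _] := selfsim_cycle x hx.
  by have /andP[] := bd _ _ h1 (sub1 _ (selfsim_itv _ hx)); rewrite /=; lra.
have I3 y : (iter 3 f @` renJ f) y -> ui c 1 <= y <= ui c 6.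
  rewrite JE => -[_ [x hx <-] <-]; have [_ _ -> _ _] := selfsim_cycle x hx.
  by have /andP[] := bd _ _ h3 (sub1 _ (selfsim_itv _ hx)); rewrite /=; lra.
have I4 y : (iter 4 f @` renJ f) y -> ui c 7 <= y <= ui c 2.
  rewrite JE => -[_ [x hx <-] <-]; have [_ _ _ -> _] := selfsim_cycle x hx.
  by have /andP[] := bd _ _ h4 (sub1 _ (selfsim_itv _ hx)); rewrite /=; lra.
exists c; split.
- exact: selfsim_unimodal.
- by rewrite !critical_orbit// ui3E ui8E /shrink; have := mulr_gt0 s0 c0;
    have : 0 < s * (1 - c) by [apply: mulr_gt0; lra]; lra.
- split; first by rewrite JE => _ [x hx <-]; exact: shrink_unit.
  move=> /(_ 0); rewrite JE => h.
  have [|x /(shrink_itv _ _ H)] := h; first by apply/itvccE; lra.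
  by move=> ? ?; lra.
split; first split.
- apply/trivIsetP.
  have key i j : (i < j < 5)%N ->
      forall x, (iter i f @` renJ f) x -> (iter j f @` renJ f) x -> False.
    move=> /andP[ij j5] x; have i5 := ltn_trans ij j5.
    case: i ij i5 => [|[|[|[|[|i]]]]] //; case: j j5 => [|[|[|[|[|j]]]]] // _ _ _ hi hj;
      first [have := I0 _ hi|have := I1 _ hi|have := I3 _ hi|have := I4 _ hi|have := I5 _ hi];
      first [have := I0 _ hj|have := I1 _ hj|have := I3 _ hj|have := I4 _ hj|have := I5 _ hj];
      lra.
  have key2 i j : (i < j < 5)%N ->
      (iter i f @` renJ f)° `&` (iter j f @` renJ f)° = set0.
    move=> ij; rewrite -subset0 => z [/interior_subset hi /interior_subset hj].
    exact: key ij z hi hj.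
  move=> i j /= hi hj; rewrite neq_ltn => /orP[ij|ij].
    by apply: key2; rewrite ij.
  by rewrite setIC; apply: key2; rewrite ij.
- by move=> x y /I1 hx /I2 hy; lra.
- by move=> x y /I2 hx /I3 hy; lra.
- by move=> x y /I3 hx /I4 hy; lra.
- by move=> x y /I4 hx /I5 hy; lra.
rewrite JE => _ [_ [x hx <-] <-]; have [_ _ _ _ ->] := selfsim_cycle x hx.
by exists (f x) => //; exact: selfsim_itv.
Qed.

End Derivative.

(** Along the orbit of 1 under [shrink], [1 - f] is exactly [s^(2n)] while the
    distance to [c] is [s^n (1 - c)]. *)
Lemma selfsim_quadratic_tip : quadratic_tip f c.
Proof.
have H := cstar_inside; have [s0 _ _] := H; have [c0 c1 s1] := scale_bounds _ _ H.
have [fA fS] := fsim; have fc := selfsim_fc _ _ H _ _ fsim.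
pose y n := iter n (shrink s c) 1.
have yu n : `[0, 1] (y n).
  by elim: n => [|n IH]; [apply/itvccE; rewrite /y /=; lra|exact: shrink_unit].
have yc n : y n - c = (- s) ^+ n * (1 - c) by exact: iter_shrinkB.
have c1' : 1 - c != 0 by lra.
have fy n : f (y n) - f c = - ((- s) ^+ n) ^+ 2.
  elim: n => [|n IH].
    by rewrite /y /= fA ?psi1 ?u1 ?fc ?expr0 ?expr1n ?sub0r//; exact: fundom1.
  rewrite {1}/y iterS -/(y n) (fS _ (yu n)) /tau fc.
  have -> : 1 + s ^+ 2 * (f (y n) - 1) - 1 = s ^+ 2 * (f (y n) - f c).
    by rewrite fc; ring.
  by rewrite IH [(- s) ^+ n.+1]exprS; ring.
have sn n : (- s) ^+ n != 0 by rewrite expf_neq0// oppr_eq0 gt_eqF.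
exists y, ((1 - c) ^- 2); split.
- by move=> n; split=> //; rewrite -subr_eq0 yc mulf_neq0.
- have -> : y = fun n => c + (- s) ^+ n * (1 - c).
    by apply/funext => n; rewrite -yc addrC subrK.
  rewrite -[X in _ --> X]addr0 -[X in _ --> c + X](mul0r (1 - c)).
  apply: cvgD; first exact: cvg_cst.
  apply: cvgMl; apply: cvg_expr; by rewrite normrN gtr0_norm.
- by rewrite invr_gt0 exprn_gt0//; lra.
- have -> : (fun n => (f (y n) - f c) / (y n - c) ^+ 2) = fun=> - (1 - c) ^- 2.
    by apply/funext => n; rewrite fy yc; field; rewrite c1' sn.
  exact: cvg_cst.
Qed.

End Selfsim.

Lemma dpsi_end dpsi (i : nat) (e p d : R) :
  (forall x, fundom s c x -> has_deriv_within (fundom s c) psi x (dpsi x)) ->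
  i \in [:: 1; 3; 4; 5]%N ->
  stil c i 1 = e -> stil c i 0 = p -> p != e ->
  dpsi e = (u c p - u c e) / (p - e).
Proof.
move=> pd hi e1 e0 pe; have h1 : `[0, 1] (1 : R) by apply/itvccE; lra.
have st t : e + t * (p - e) = stil c i (1 - t).
  by rewrite [RHS]stil_affine e1 e0; ring.
have st' (t : R) : 0 <= t <= 1 -> `[0, 1] (1 - t) by move=> ?; apply/itvccE; lra.
have Ae : fundom s c e by rewrite -e1; exact: stil_fundom.
apply: (has_deriv_within_affine _ _ _ _ _ _ pe _ _ (pd _ Ae)).
  by move=> t ht; rewrite st; apply: stil_fundom => //; exact: st'.
have pe1 : psi e = u c e by rewrite -e1 psi_affine//; ring.
move=> t ht; rewrite st (psi_affine _ _ hi (st' _ ht)) e1 e0 pe1.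
by field; rewrite subr_eq0.
Qed.

Lemma slope_onE (i : nat) : i \in [:: 1; 5]%N ->
  slope_on c g i 2 =
  - s * ((u c (stil c i 0) - u c (stil c i 1)) / (stil c i 0 - stil c i 1)).
Proof.
have [s0 _ _] := cstar_inside.
have [[_ [[h1 _ _ _ h5] _]] _] := cstar.
move=> hi; have hi' : i \in [:: 1; 3; 4; 5]%N.
  by move: hi; rewrite !inE => /orP[->|->]; rewrite ?orbT.
have [_ e0 e1] := gP i 2 hi' isT.
rewrite /slope_on e0 e1 !Ipar_S !u_shrink /tau /shrink /Ipar /=.
have ne : stil c i 0 - stil c i 1 != 0.
  move: hi; rewrite !inE => /orP[/eqP->|/eqP->] /=.
    by apply: lt0r_neq0; lra.
  by apply: ltr0_neq0; lra.
field; rewrite ne ?andbT /=.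
have -> : forall a b : R, c - s * (a - c) - (c - s * (b - c)) = s * (b - a).
  by move=> a b; ring.
by rewrite mulf_neq0// gt_eqF.
Qed.

(** The slopes imposed at [y_1] and [z_1] are those of the parabola on
    [I_5^2 = shrink I_5^1] and [I_1^2 = shrink I_1^1], hence [- s] times the slopes of
    [psi] at 1 and 0. *)
Lemma dpsi_match dpsi :
  (forall x, fundom s c x -> has_deriv_within (fundom s c) psi x (dpsi x)) ->
  dpsi (y1 c) = slope_on c g 5 2 -> dpsi (z1 c) = slope_on c g 1 2 ->
  dpsi (shrink s c 0) = 0 + - s * (dpsi 0 - 0) /\
  dpsi (shrink s c 1) = 0 + - s * (dpsi 1 - 0).
Proof.
have [[_ [[h1 _ _ _ h5] _]] _] := cstar.
move=> pd; rewrite /y1 /z1 stil2E !slope_onE// => -> ->.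
rewrite !add0r !subr0; split; congr (_ * _); apply/esym.
- have e : stil c 1 1 = 0 by rewrite /=; ring.
  by rewrite e; apply: (dpsi_end _ 1) => //; rewrite gt_eqF//= subr0 mulr1.
- have e : stil c 5 1 = 1 by rewrite /=; ring.
  by rewrite e; apply: (dpsi_end _ 5) => //; rewrite lt_eqF//=; lra.
Qed.

Lemma calG_graphE : calG_graph c psi = ext_graph s c (tau s) 1 psi.
Proof. by rewrite /calG_graph AdomE /Fmap stil2E stil5E. Qed.

Lemma calG_selfsim : selfsim s c (tau s) psi (calG c psi) /\
  graph_on `[0, 1] (calG c psi) = calG_graph c psi.
Proof.
rewrite /calG calG_graphE; apply: ext_selfsim.
- exact: cstar_inside.
- by rewrite /tau subrr mulr0 addr0.
- exact: psi_match0.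
- exact: psi_match1.
Qed.

Lemma iter_renorm_selfsim f n : selfsim s c (tau s) psi f ->
  selfsim s c (tau s) psi (iter n (@renorm R) f).
Proof. by move=> h; elim: n => //= n IH; exact: renorm_selfsim. Qed.

Lemma nestE f n x : selfsim s c (tau s) psi f -> nest f n x = iter n (shrink s c) x.
Proof.
move=> h; elim: n x => //= n IH x.
rewrite IH renh_selfsim; last exact: iter_renorm_selfsim.
by rewrite -iterSr.
Qed.

Lemma nest_cvg0 f : selfsim s c (tau s) psi f ->
  `|nest f n 1 - nest f n 0| @[n --> \oo] --> (0 : R).
Proof.
have [s0 _ _] := cstar_inside; have [_ _ s1] := scale_bounds _ _ cstar_inside.
move=> h; have -> : (fun n => `|nest f n 1 - nest f n 0|) = GRing.exp s.
  apply/funext => n; rewrite !nestE//.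
  have -> : iter n (shrink s c) 1 - iter n (shrink s c) 0 =
    (iter n (shrink s c) 1 - c) - (iter n (shrink s c) 0 - c) by ring.
  rewrite !iter_shrinkB -mulrBr.
  have -> : 1 - c - (0 - c) = 1 by ring.
  by rewrite mulr1 normrX normrN gtr0_norm.
by apply: cvg_expr; rewrite gtr0_norm.
Qed.

End Cstar.

Theorem theorem3p5 (R : realType) (c : R) (g psi : R -> R) :
  is_cstar c -> is_g c g -> is_psi c g psi ->
  (graph_on `[0, 1] (calG c psi) = calG_graph c psi /\
   forall x, Dset c x -> calG c psi x = g x) /\
  [/\ unimodal (calG c psi) c,
      C1Lip `[0, 1] (calG c psi),
      quadratic_tip (calG c psi) c,
      quint_inf_renormalizable (calG c psi)
    & forall x : R, `[0, 1] x -> renorm (calG c psi) x = calG c psi x].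
Proof.
move=> cs gP psiP; have H := cstar_inside _ cs.
have [Gsim Ggraph] := calG_selfsim _ cs _ _ gP psiP.
have [_ [_ [dpsi dpsiC [dpos dneg dy dz]]]] := psiP.
rewrite (AdomE _ cs) in dpsiC.
have [[pd _] _] := dpsiC.
have [m0 m1] := dpsi_match _ cs _ _ gP psiP dpsi pd dy dz.
have T0 : 0 + - ratio c * (0 - 0) = 0 :> R by ring.
have [dfsim _] := ext_selfsim _ _ (scaling 0 (- ratio c)) 0 dpsi H T0 m0 m1.
have dnz x : fundom (ratio c) c x -> dpsi x != 0.
  by rewrite -(AdomE _ cs) => -[hx|hx]; rewrite ?(gt_eqF (dpos _ hx)) ?(lt_eqF (dneg _ hx)).
have quint f : selfsim (ratio c) c (tau (ratio c)) psi f -> quint_renormalizable f.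
  move=> fsim.
  exact: (selfsim_quint_renormalizable _ cs _ _ gP psiP _ fsim _ _ dpsiC dnz dfsim).
split; first by split=> // x; exact: (selfsim_Dset _ cs _ _ gP psiP _ Gsim).
split.
- exact: (selfsim_unimodal _ cs _ _ gP psiP _ Gsim _ _ dpsiC dnz dfsim).
- eexists; exact: (selfsim_psi_C1Lip _ cs _ _ psiP _ Gsim _ _ dpsiC dfsim).
- exact: (selfsim_quadratic_tip _ cs _ _ gP psiP _ Gsim).
- split; last exact: (nest_cvg0 _ cs _ _ gP psiP _ Gsim).
  by move=> n; apply/quint/(iter_renorm_selfsim _ cs _ _ gP psiP _ _ Gsim).
- exact: (renorm_selfsim_eq _ cs _ _ gP psiP _ Gsim).
Qed.
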